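(* Let $0<q\leq 1$, $1\leq r\leq\infty$, $\varepsilon\geq 0$. Let $A\in\mathbb{R}^{m\times n}$, let $f\in\mathbb{R}^n$, and suppose we observe $y=Af+z$ with $z\in\mathbb{R}^m$, $\|z\|_r\leq\varepsilon$. Let $D\in\mathbb{R}^{n\times d}$ be a frame with frame bounds $0<\mathcal{L}\leq\mathcal{U}<\infty$. Fix positive integers $s,a$ with $s<a$, and set $\rho=s/a$, $\kappa=\mathcal{U}/\mathcal{L}$. Assume that the $(D^{\dagger},q)$-RIP constants of $A$ satisfy $$\rho^{1-q/2}\left(\rho^{2/q-1}+1\right)^{q/2}\kappa^q(1+\delta_a)<1-\delta_{s+a}.$$ Then any solution $\hat{f}$ of $$\min_{\tilde{f}\in\mathbb{R}^n}\|D^*\tilde{f}\|_q\quad\text{subject to}\quad\|A\tilde{f}-y\|_r\leq\varepsilon$$ satisfies $$\|\hat{f}-f\|_2\leq C_1\frac{\|D^*f-(D^*f)_{[s]}\|_q}{s^{1/q-1/2}}+C_2m^{1/q-1/r}\varepsilon$$ and $$\|D^*\hat{f}-D^*f\|_q^q\leq C_3\|D^*f-(D^*f)_{[s]}\|_q^q+C_4a^{1-q/2}m^{1-q/r}\varepsilon^q,$$ where $C_1,C_2,C_3,C_4$ are positive constants depending only on $\delta_a$, $\delta_{s+a}$, $\rho$, $q$, $\mathcal{L}$ and $\kappa$.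
   Context: $D\in\mathbb{R}^{n\times d}$ is a frame with frame bounds $0<\mathcal{L}\leq\mathcal{U}<\infty$ if $\mathcal{L}\|f\|_2^2\leq\|D^*f\|_2^2\leq\mathcal{U}\|f\|_2^2$ for all $f\in\mathbb{R}^n$. $D^{\dagger}=(DD^* )^{-1}D$ is the canonical dual frame. For a matrix $E\in\mathbb{R}^{n\times d}$, $A$ obeys the $(E,q)$-RIP of order $k$ with constant $\delta\in[0,1)$ if $(1-\delta)\|Ev\|_2^q\leq\|AEv\|_q^q\leq(1+\delta)\|Ev\|_2^q$ for all $v\in\mathbb{R}^d$ with at most $k$ nonzero entries; the $(E,q)$-RIP constant $\delta_k$ is the smallest such $\delta$. Here $\|u\|_q=(\sum_j|u_j|^q)^{1/q}$, $\|u\|_\infty=\max_j|u_j|$, and $x_{[s]}$ keeps the $s$ largest entries of $x$ in magnitude and zeros the rest. *)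

(* Defs.v *)
From mathcomp Require Import all_boot all_order all_algebra.
From mathcomp Require Import all_classical all_reals.
From mathcomp Require Import exp.
Set Implicit Arguments. Unset Strict Implicit. Unset Printing Implicit Defensive.
Import Order.TTheory GRing.Theory Num.Theory.
Local Open Scope ring_scope.

Section Defs.
Variable R : realType.

Definition lqnorm (q : R) k (u : 'cV[R]_k) : R :=
  (\sum_(j < k) `|u j 0| `^ q) `^ q^-1.

Definition lqpow (q : R) k (u : 'cV[R]_k) : R := \sum_(j < k) `|u j 0| `^ q.

Definition linfnorm k (u : 'cV[R]_k) : R := \big[Num.max/0]_(j < k) `|u j 0|.

Definition lrnorm (r : \bar R) k (u : 'cV[R]_k) : R :=
  match r with
  | EFin r' => lqnorm r' u
  | _ => linfnorm u
  end.

Definition einv (r : \bar R) : R :=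
  match r with EFin r' => r'^-1 | _ => 0 end.

Definition nnz k (v : 'cV[R]_k) : nat := #|[set j : 'I_k | v j 0 != 0]|.

Definition is_frame n d (D : 'M[R]_(n, d)) (L U : R) : Prop :=
  0 < L /\ L <= U /\
  forall f : 'cV[R]_n,
    L * lqnorm 2 f ^+ 2 <= lqnorm 2 (D^T *m f) ^+ 2 /\
    lqnorm 2 (D^T *m f) ^+ 2 <= U * lqnorm 2 f ^+ 2.

Definition dual_frame n d (D : 'M[R]_(n, d)) : 'M[R]_(n, d) :=
  invmx (D *m D^T) *m D.

Definition EqRIP m n d (A : 'M[R]_(m, n)) (E : 'M[R]_(n, d)) (q : R)
  (k : nat) (delta : R) : Prop :=
  0 <= delta < 1 /\
  forall v : 'cV[R]_d, (nnz v <= k)%N ->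
    (1 - delta) * lqnorm 2 (E *m v) `^ q <= lqpow q (A *m (E *m v)) /\
    lqpow q (A *m (E *m v)) <= (1 + delta) * lqnorm 2 (E *m v) `^ q.

Definition is_RIP_constant m n d (A : 'M[R]_(m, n)) (E : 'M[R]_(n, d)) (q : R)
  (k : nat) (delta : R) : Prop :=
  EqRIP A E q k delta /\ forall delta', EqRIP A E q k delta' -> delta <= delta'.

(* x_[s]: keep the s largest entries of x in magnitude (ties broken by index
   order via stable sort), zero the rest *)
Definition head_s (s : nat) k (x : 'cV[R]_k) : 'cV[R]_k :=
  let T := take s (sort (fun i j : 'I_k => `|x j 0| <= `|x i 0|) (enum 'I_k)) in
  \col_i (if i \in T then x i 0 else 0).

End Defs.

(* Main.v *)
(* Put [h = fhat - f], [x = D^T h], let [T] be the support of the head of [D^T f], and let [B]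
   carry the [a] largest entries of [x] off [T].  Minimality of [fhat] gives the cone
   constraint on [x], and comparing every block of [a] sorted entries with the mean of the
   previous one bounds everything outside [T :|: B] by
   [rho^(1 - q/2) (P^q + 2 eta)], with [P] the Euclidean norm of [x] on [T :|: B] and [eta] the
   scaled best [s]-term error.  As the dual frame inverts [D^T] on its range, [h] splits
   into the synthesis of the head and of the tail, and the RIP of order [s + a] controls the
   synthesized head [X] by the noise and the tail.  The frame bounds give
   [P^2 <= U^(1/2) X |x|], which closes the loop: the hypothesis on the RIP constants lets
   the term in [P^q] be absorbed. *)
Require Import Defs.
From mathcomp Require Import all_boot all_order all_algebra.
From mathcomp Require Import all_classical all_reals.
From mathcomp Require Import exp.
From mathcomp Require Import ring lra.
Set Implicit Arguments. Unset Strict Implicit. Unset Printing Implicit Defensive.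
Import Order.TTheory GRing.Theory Num.Theory.
Local Open Scope ring_scope.

(** * Real powers: subadditivity, tangent lines and the power-mean inequality *)

Lemma ler_powRl (R : realType) (p x y : R) :
  0 <= p -> 0 <= x -> x <= y -> x `^ p <= y `^ p.
Proof.
by move=> p0 x0 xy; apply: ge0_ler_powR => //; rewrite nnegrE// (le_trans x0).
Qed.

Lemma powRVK (R : realType) (p x : R) : 0 < p -> 0 <= x -> (x `^ p^-1) `^ p = x.
Proof. by move=> p0 x0; rewrite -powRrM mulVf ?gt_eqF// powRr1. Qed.

Lemma powRKV (R : realType) (p x : R) : 0 < p -> 0 <= x -> (x `^ p) `^ p^-1 = x.
Proof. by move=> p0 x0; rewrite -powRrM mulfV ?gt_eqF// powRr1. Qed.

(** A ratio in [(0, 1]] is at most its own [p]-th power. Applied to [x / (x + y)] and [y / (x + y)],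
    whose sum is 1, and scaled by [(x + y)^p], this gives the claim. *)
Lemma powR_subadd (R : realType) (p x y : R) :
  0 < p <= 1 -> 0 <= x -> 0 <= y -> (x + y) `^ p <= x `^ p + y `^ p.
Proof.
move=> /andP[p0 p1]; rewrite le0r => /predU1P[-> y0|x0].
  by rewrite add0r powR0 ?gt_eqF// add0r.
rewrite le0r => /predU1P[->|y0]; first by rewrite addr0 lerDl powR_ge0.
have s0 : 0 < x + y by rewrite addr_gt0.
have part u : 0 < u -> u <= x + y -> u / (x + y) * (x + y) `^ p <= u `^ p.
  move=> u0 us; have us0 : 0 <= u / (x + y) by rewrite divr_ge0 // ltW.
  rewrite -{2}(divfK (lt0r_neq0 s0) u) (powRM p us0 (ltW s0)).
  rewrite ler_wpM2r ?powR_ge0// ger1_powR// divr_gt0//=.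
  by rewrite ler_pdivrMr// mul1r.
rewrite -[leLHS]mul1r -(divff (lt0r_neq0 s0)) mulrDl mulrDl lerD// part//.
  by rewrite lerDl ltW.
by rewrite lerDr ltW.
Qed.

(** The tangent at 1 lies above the concave power. For [t < 1] this is Young's inequality for the
    product of [y^t] and 1 with exponents [1/t] and [1/(1-t)]. *)
Lemma powR_tangent (R : realType) (t y : R) :
  0 < t <= 1 -> 0 <= y -> y `^ t <= 1 + t * (y - 1).
Proof.
move=> /andP[t0]; rewrite le_eqVlt => /predU1P[-> y0|t1 y0].
  by rewrite powRr1//; lra.
have t1' : 0 < 1 - t by rewrite subr_gt0.
have := @conjugate_powR R (y `^ t) 1 t^-1 (1 - t)^-1 (powR_ge0 _ _) ler01.
rewrite !invr_gt0 !invrK powRKV// powR1 mulr1 => /(_ t0 t1').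
by move=> /(_ ltac:(lra)); lra.
Qed.

(** Jensen's inequality for the concave power [t]: each term is compared with the tangent at the
    mean [b]. *)
Lemma sum_powR_le (R : realType) (I : finType) (B : {pred I}) (t : R) (y : I -> R) :
  0 < t <= 1 -> (forall i, 0 <= y i) ->
  \sum_(i in B) y i `^ t <= #|B|%:R `^ (1 - t) * (\sum_(i in B) y i) `^ t.
Proof.
move=> t01 y0; have /andP[t0 t1] := t01.
have: 0 <= \sum_(i in B) y i by apply: sumr_ge0.
rewrite le0r => /predU1P[S0|S0].
  rewrite big1 ?mulr_ge0 ?powR_ge0// => i iB.
  by rewrite (psumr_eq0P _ S0)// powR0// gt_eqF.
have cB : 0 < #|B|%:R :> R.
  rewrite ltr0n lt0n; apply: contraTneq S0 => /card0_eq B0.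
  by rewrite big_pred0// ltxx.
set S := \sum_(i in B) y i in S0 *; set b := S / #|B|%:R.
have b0 : 0 < b by rewrite divr_gt0.
(* The linear corrections [y i / b - 1] sum to zero, so the tangents at [b] add up to [#|B| * b^t],
   which is the right-hand side. *)
have -> : #|B|%:R `^ (1 - t) * S `^ t = \sum_(i in B) b `^ t * (1 + t * (y i / b - 1)).
  rewrite -mulr_sumr big_split/= sumr_const -mulr_sumr sumrB -mulr_suml.
  rewrite sumr_const -/S {2}/b invf_div mulrCA divff ?gt_eqF// mulr1 subrr mulr0.
  rewrite addr0 powRB; last by rewrite lt0r_neq0 ?implybT.
  rewrite (powRr1 (ltW cB)) -{1}(divfK (lt0r_neq0 cB) S) (powRM _ (ltW b0) (ltW cB)).
  by rewrite mulrAC mulrA mulfK ?gt_eqF ?powR_gt0// mulrC.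
apply: ler_sum => i _; rewrite -{1}(divfK (lt0r_neq0 b0) (y i)).
rewrite (powRM _ (divr_ge0 (y0 i) (ltW b0)) (ltW b0)) mulrC ler_wpM2l ?powR_ge0//.
by apply: powR_tangent => //; exact: divr_ge0 (y0 i) (ltW b0).
Qed.

(** * Decomposition into blocks of decreasing entries *)

(** Greedy choice: a maximal element of what is left is added [a] times. The alternative [B == S]
    covers a set exhausted too early. *)
Lemma top_subset (R : realType) (I : finType) (w : I -> R) (a : nat) (S : {set I}) :
  exists B : {set I}, [/\ B \subset S, (#|B| <= a)%N,
    (B == S) || (#|B| == a) & {in B & S :\: B, forall i j, w j <= w i}].
Proof.
elim: a => [|a [B [BS Ba h top]]].
  exists finset.set0; rewrite finset.sub0set cards0 eqxx orbT; split => // i j.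
  by rewrite finset.inE.
have [SB0|[j0 j0S]] := finset.set_0Vmem (S :\: B).
  exists B; rewrite BS (leq_trans Ba)//; split => //.
  by rewrite finset.eqEsubset BS -finset.setD_eq0 SB0 eqxx.
have [i0 /= i0S i0max] := arg_maxP w j0S.
exists (i0 |: B); have /finset.setDP[i0S' i0B] := i0S.
have cB : #|B| = a.
  case/predU1P: h => [BS'|/eqP//]; by rewrite BS' i0S' in i0B.
rewrite finset.subUset BS finset.sub1set i0S' cardsU1 i0B cB; split => //.
  by rewrite eqxx orbT.
move=> i j /finset.setU1P[->|iB]; rewrite !finset.inE negb_or => /andP[/andP[ji jB] jS].
  by apply: i0max; apply/finset.setDP.
by apply: top => //; rewrite finset.inE jB.
Qed.

(* By induction on [S]: after its [a] largest entries are removed, the remaining ones lie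
   below their mean. *)
Lemma block_bound (R : realType) (I : finType) (w : I -> R) (F : {set I} -> R)
    (p C : R) (a : nat) :
  0 < p -> 0 <= C -> (0 < a)%N -> (forall i, 0 <= w i) ->
  (forall B B' : {set I}, [disjoint B & B'] -> F (B :|: B') <= F B + F B') ->
  (forall B : {set I}, (#|B| <= a)%N -> F B <= C * (\sum_(i in B) w i `^ p) `^ p^-1) ->
  forall (S : {set I}) M, 0 <= M -> {in S, forall i, w i <= M} ->
  F S <= C * a%:R `^ p^-1 * (M + (\sum_(i in S) w i) / a%:R).
Proof.
move=> p0 C0 a0 w0 FU Fa S.
have a0R : 0 < a%:R :> R by rewrite ltr0n.
have [k] := ubnP #|S|; elim: k S => // k IH S /ltnSE Sk M M0 wM.
have [B [BS Ba cB top]] := @top_subset R I w a S.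
have FB : F B <= C * a%:R `^ p^-1 * M.
  apply: le_trans (Fa B Ba) _; rewrite -mulrA ler_wpM2l//.
  rewrite -(powRKV p0 M0) -powRM ?powR_ge0//.
  apply: ler_powRl; rewrite ?invr_ge0 ?(ltW p0)//.
    by apply: sumr_ge0 => i _; exact: powR_ge0.
  apply: le_trans (_ : \sum_(i in B) M `^ p <= _).
    apply: ler_sum => i iB; apply: ler_powRl; rewrite ?(ltW p0)//.
    by rewrite wM// (fintype.subsetP BS).
  by rewrite sumr_const -[leLHS]mulr_natl ler_wpM2r ?powR_ge0// ler_nat.
have K0 : 0 <= C * a%:R `^ p^-1 by rewrite mulr_ge0// powR_ge0.
have sw0 A : 0 <= \sum_(i in A) w i by apply: sumr_ge0.
have [SB|SB] := eqVneq B S.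
  by rewrite -SB (le_trans FB)// ler_wpM2l// lerDl divr_ge0.
have {}cB : #|B| = a by move: cB; rewrite (negPf SB) => /eqP.
set M' := (\sum_(i in B) w i) / a%:R.
(* The mean [M'] of the full block [B] dominates every remaining entry, so it replaces [M] in the
   induction; [M'] is also the share of [B] in the final average, so the two bounds add up
   exactly. *)
have FSB : F (S :\: B) <= C * a%:R `^ p^-1 * (M' + (\sum_(i in S :\: B) w i) / a%:R).
  apply: IH.
  - rewrite (leq_trans _ Sk)// proper_card// finset.properEneq finset.subsetDl andbT.
    apply/eqP => E; suff: #|B| = 0%N by move=> B0; rewrite -cB B0 in a0.
    apply: eq_card0 => i; apply/negP => iB; have := fintype.subsetP BS _ iB.
    by rewrite -E finset.inE iB.
  - by rewrite divr_ge0.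
  - move=> j jS; rewrite ler_pdivlMr// mulr_natr -cB -sumr_const.
    by apply: ler_sum => i iB; apply: top.
have dis : [disjoint B & S :\: B].
  by rewrite -finset.setI_eq0 finset.setIDA finset.setDIl finset.setDv finset.set0I.
rewrite -{1}(finset.setID S B) (finset.setIidPr BS) (le_trans (FU _ _ dis))//.
rewrite [\sum_(i in S) _](big_setID B)/= (finset.setIidPr BS).
rewrite (le_trans (lerD FB FSB))// -mulrDr ler_wpM2l// lerD2l.
by rewrite mulrDl.
Qed.

(** With the top block [B] set aside, its mean is an admissible [M] in [block_bound], and the sums
    over [B] and [S :\: B] merge into the sum over [S]. *)
Lemma tail_bound (R : realType) (I : finType) (w : I -> R) (F : {set I} -> R)
    (p C : R) (a : nat) (S B : {set I}) :
  0 < p -> 0 <= C -> (0 < a)%N -> (forall i, 0 <= w i) ->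
  (forall B B' : {set I}, [disjoint B & B'] -> F (B :|: B') <= F B + F B') ->
  (forall B : {set I},
     (#|B| <= a)%N -> F B <= C * (\sum_(i in B) w i `^ p) `^ p^-1) ->
  B \subset S -> (B == S) || (#|B| == a) ->
  {in B & S :\: B, forall i j, w j <= w i} ->
  F (S :\: B) <= C * a%:R `^ (p^-1 - 1) * \sum_(i in S) w i.
Proof.
move=> p0 C0 a0 w0 FU Fa BS cB top.
have a0R : 0 < a%:R :> R by rewrite ltr0n.
have sw0 (A : {set I}) : 0 <= \sum_(i in A) w i by apply: sumr_ge0.
have bound := block_bound p0 C0 a0 w0 FU Fa.
have [SB|SB] := eqVneq B S.
  (* Here the tail is empty, so the bound is used with [M = 0]. *)
  have /bound : {in S :\: B, forall i, w i <= 0}.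
    by move=> i; rewrite SB finset.setDv finset.inE.
  move=> /(_ (lexx 0)) /le_trans; apply.
  by rewrite SB finset.setDv big_set0 mul0r addr0 mulr0 !mulr_ge0// powR_ge0.
have {}cB : #|B| = a by move: cB; rewrite (negPf SB) => /eqP.
have /bound : {in S :\: B, forall j, w j <= (\sum_(i in B) w i) / a%:R}.
  move=> j jS; rewrite ler_pdivlMr// mulr_natr -cB -sumr_const.
  by apply: ler_sum => i iB; apply: top.
move=> /(_ (divr_ge0 (sw0 _) (ler0n _ _))) /le_trans; apply.
rewrite -mulrDl -{1}(finset.setIidPr BS) -big_setID powRB; last first.
  by rewrite lt0r_neq0 ?implybT.
by rewrite powRr1 ?ler0n// -!mulrA [a%:R^-1 * _]mulrC.
Qed.

(** * Inner products, the frame operator and the canonical dual frame *)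

Definition dotv (R : realType) (k : nat) (u v : 'cV[R]_k) : R := (u^T *m v) 0 0.

Lemma dotvE (R : realType) k (u v : 'cV[R]_k) : dotv u v = \sum_i u i 0 * v i 0.
Proof. by rewrite /dotv mxE; apply: eq_bigr => i _; rewrite mxE. Qed.

Lemma dotv_ge0 (R : realType) k (u : 'cV[R]_k) : 0 <= dotv u u.
Proof. by rewrite dotvE; apply: sumr_ge0 => i _; rewrite -expr2 sqr_ge0. Qed.

Lemma dotv_eq0 (R : realType) k (u : 'cV[R]_k) : dotv u u = 0 -> u = 0.
Proof.
rewrite dotvE => u0; apply/colP => i; rewrite mxE; apply/eqP.
rewrite -sqrf_eq0 expr2; apply/eqP; apply: (psumr_eq0P _ u0) => // j _.
by rewrite -expr2 sqr_ge0.
Qed.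

Lemma dotv_trmx (R : realType) k l (M : 'M[R]_(k, l)) (u : 'cV[R]_k) (v : 'cV[R]_l) :
  dotv (M^T *m u) v = dotv u (M *m v).
Proof. by rewrite /dotv trmx_mul trmxK mulmxA. Qed.

Lemma dotv_CauchySchwarz (R : realType) k (u v : 'cV[R]_k) :
  dotv u v ^+ 2 <= dotv u u * dotv v v.
Proof.
have := dotv_ge0 v; rewrite le0r => /predU1P[/dotv_eq0->|v0].
  by rewrite {1}/dotv mulmx0 mxE expr0n mulr_ge0 ?dotv_ge0.
rewrite -subr_ge0 -(pmulr_rge0 _ v0).
(* Up to the factor [dotv v v], the gap is the squared norm of a multiple of the component of [u]
   orthogonal to [v]. *)
suff -> : dotv v v * (dotv u u * dotv v v - dotv u v ^+ 2)
        = dotv (dotv v v *: u - dotv u v *: v) (dotv v v *: u - dotv u v *: v).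
  exact: dotv_ge0.
set b := dotv v v; set c := dotv u v.
rewrite [RHS]dotvE.
have -> : \sum_i (b *: u - c *: v) i 0 * (b *: u - c *: v) i 0
   = b ^+ 2 * dotv u u - 2 * b * c * dotv u v + c ^+ 2 * dotv v v.
  rewrite !dotvE !mulr_sumr -sumrB -big_split/=.
  by apply: eq_bigr => i _; rewrite !mxE; ring.
by rewrite -/b -/c; ring.
Qed.

(** Turns Euclidean norms into powers [q / 2] of inner products, the form used in all later
    estimates. *)
Lemma lqnorm2E (R : realType) k (u : 'cV[R]_k) (q : R) :
  lqnorm 2 u `^ q = dotv u u `^ (q / 2).
Proof.
rewrite /lqnorm -powRrM mulrC dotvE; congr (_ `^ _).
by apply: eq_bigr => i _; rewrite powR_mulrn// real_normK ?num_real.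
Qed.

Lemma lqnorm2_sqr (R : realType) k (u : 'cV[R]_k) : lqnorm 2 u ^+ 2 = dotv u u.
Proof. by rewrite -powR_mulrn ?powR_ge0// lqnorm2E divff ?pnatr_eq0// powRr1 ?dotv_ge0. Qed.

Section Frame.
Variables (R : realType) (n d : nat) (D : 'M[R]_(n, d)) (L U : R).
Hypothesis frameD : is_frame D L U.

Lemma frame_lower (f : 'cV[R]_n) : L * dotv f f <= dotv (D^T *m f) (D^T *m f).
Proof. by have [_ [_ /(_ f)[]]] := frameD; rewrite !lqnorm2_sqr. Qed.

Lemma frame_upper (f : 'cV[R]_n) : dotv (D^T *m f) (D^T *m f) <= U * dotv f f.
Proof. by have [_ [_ /(_ f)[]]] := frameD; rewrite !lqnorm2_sqr. Qed.

(** A vector [f] in the kernel of the frame operator has [D^T *m f] of norm zero, so the lower frame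
    bound forces [f = 0]. *)
Lemma frame_unitmx : D *m D^T \in unitmx.
Proof.
have [L0 _] := frameD.
rewrite -row_free_unit -kermx_eq0; apply/eqP/row_matrixP => i; rewrite row0.
apply: trmx_inj; rewrite trmx0; set f := (row i _)^T.
have Sf : D *m D^T *m f = 0.
  apply: trmx_inj; rewrite trmx_mul trmx_mul trmxK /f trmxK.
  by rewrite -row_mul mulmx_ker row0 trmx0.
apply: dotv_eq0; apply/eqP; rewrite eq_le dotv_ge0 andbT -(pmulr_rle0 _ L0).
by rewrite (le_trans (frame_lower f))// dotv_trmx mulmxA Sf /dotv mulmx0 mxE.
Qed.

Lemma mul_frame_dual (v : 'cV[R]_d) : D *m D^T *m (dual_frame D *m v) = D *m v.
Proof. by rewrite mulmxA /dual_frame mulmxA mulmxV ?frame_unitmx// mul1mx. Qed.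

Lemma dual_frameK (f : 'cV[R]_n) : dual_frame D *m (D^T *m f) = f.
Proof. by rewrite mulmxA -[dual_frame D *m _]mulmxA mulVmx ?frame_unitmx// mul1mx. Qed.

(* [D^T *m (dual_frame D *m v)] is the orthogonal projection of [v] on the range of [D^T]. *)
Lemma dual_frame_bound (v : 'cV[R]_d) :
  L * dotv (dual_frame D *m v) (dual_frame D *m v) <= dotv v v.
Proof.
apply: le_trans (frame_lower _) _; set g := dual_frame D *m v.
have gv : dotv (D^T *m g) v = dotv (D^T *m g) (D^T *m g).
  by rewrite !dotv_trmx mulmxA mul_frame_dual.
(* By [gv] this squared norm equals [dotv v v - dotv (D^T *m g) (D^T *m g)]. *)
have := dotv_ge0 (v - D^T *m g).
rewrite {1}dotvE.
have -> : \sum_i (v - D^T *m g) i 0 * (v - D^T *m g) i 0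
   = dotv v v - 2 * dotv (D^T *m g) v + dotv (D^T *m g) (D^T *m g).
  rewrite !dotvE mulr_sumr -sumrB -big_split/=.
  by apply: eq_bigr => i _; move: (D^T *m g) => w; rewrite !mxE; ring.
by rewrite gv; lra.
Qed.

(** Meant for [v] a restriction of [D^T *m h]. Since [D *m v] is the frame operator applied to [g],
    pairing [v] with [D^T *m h] amounts to pairing [D^T *m g] with it; Cauchy-Schwarz and the upper
    frame bound finish. *)
Lemma frame_restriction_bound (v : 'cV[R]_d) (h : 'cV[R]_n) :
  dotv v v = dotv v (D^T *m h) ->
  dotv v v ^+ 2 <= U * dotv (dual_frame D *m v) (dual_frame D *m v)
                   * dotv (D^T *m h) (D^T *m h).
Proof.
move=> vE; set g := dual_frame D *m v.
have -> : dotv v v = dotv (D^T *m g) (D^T *m h).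
  by rewrite vE -[LHS]dotv_trmx -[RHS]dotv_trmx !trmxK mulmxA mul_frame_dual.
apply: le_trans (dotv_CauchySchwarz _ _) _.
by rewrite ler_wpM2r ?dotv_ge0 ?frame_upper.
Qed.

End Frame.

(** * The [q]-th power of the quasi-norm, noise and the cone constraint *)

Lemma lqnormK (R : realType) (q : R) k (u : 'cV[R]_k) :
  0 < q -> lqnorm q u `^ q = lqpow q u.
Proof. by move=> q0; rewrite powRVK// sumr_ge0// => i _; exact: powR_ge0. Qed.

Lemma lqpow_ge0 (R : realType) (q : R) k (u : 'cV[R]_k) : 0 <= lqpow q u.
Proof. by apply: sumr_ge0 => i _; exact: powR_ge0. Qed.

Lemma norm_powR_triangle (R : realType) (q x y : R) :
  0 < q <= 1 -> `|x + y| `^ q <= `|x| `^ q + `|y| `^ q.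
Proof.
move=> q01; apply: le_trans (powR_subadd q01 (normr_ge0 _) (normr_ge0 _)).
by apply: ler_powRl; rewrite ?ler_normD//; case/andP: q01 => /ltW.
Qed.

Lemma lqpowD (R : realType) (q : R) k (u v : 'cV[R]_k) :
  0 < q <= 1 -> lqpow q (u + v) <= lqpow q u + lqpow q v.
Proof.
move=> q01; rewrite -big_split/=; apply: ler_sum => i _.
by rewrite mxE norm_powR_triangle.
Qed.

Lemma lqpowN (R : realType) (q : R) k (u : 'cV[R]_k) : lqpow q (- u) = lqpow q u.
Proof. by apply: eq_bigr => i _; rewrite mxE normrN. Qed.

(** For finite [r] this is the power-mean inequality with exponent [q / r]; for [r = +oo], where
    [einv r = 0], each of the [m] entries is at most [eps]. *)
Lemma lqpow_le_lrnorm (R : realType) (q eps : R) (r : \bar R) m (u : 'cV[R]_m) :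
  0 < q <= 1 -> (1 <= r)%E -> lrnorm r u <= eps ->
  lqpow q u <= m%:R `^ (1 - q * einv r) * eps `^ q.
Proof.
move=> /andP[q0 q1]; have q0' := ltW q0; case: r => [r|_|//] /=.
  rewrite lee_fin => r1 ur; have r0 : 0 < r by rewrite (lt_le_trans _ r1).
  have qr : 0 < q / r <= 1.
    by rewrite divr_gt0//= ler_pdivrMr// mul1r (le_trans q1).
  apply: (@le_trans _ _ (m%:R `^ (1 - q / r) * lqnorm r u `^ q)); last first.
    by rewrite ler_wpM2l ?powR_ge0// ler_powRl// powR_ge0.
  have := sum_powR_le predT qr (fun j : 'I_m => powR_ge0 `|u j 0| r).
  rewrite card_ord /lqnorm -powRrM [_^-1 * q]mulrC; apply: le_trans.
  by apply: ler_sum => j _; rewrite -powRrM mulrC divfK ?gt_eqF.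
move=> ur; rewrite mulr0 subr0 powRr1 ?ler0n//.
rewrite -[in leRHS](card_ord m) mulr_natl -sumr_const.
apply: ler_sum => j _; apply: ler_powRl => //; apply: le_trans ur.
exact: (@le_bigmax _ _ _ 0 (fun j => `|u j 0|)).
Qed.

(** The [q]-triangle inequality bounds [x] on [T] by [x + h] and [h], and [h] off [T] by [x + h] and
    [x]. Adding the two and using the hypothesis on [x + h] cancels the part of [x] on [T]. *)
Lemma cone_constraint (R : realType) (q : R) k (x h : 'cV[R]_k) (T : {set 'I_k}) :
  0 < q <= 1 -> lqpow q (x + h) <= lqpow q x ->
  \sum_(i in ~: T) `|h i 0| `^ q <=
    \sum_(i in T) `|h i 0| `^ q + 2 * \sum_(i in ~: T) `|x i 0| `^ q.
Proof.
move=> q01; rewrite /lqpow.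
have split (F : 'I_k -> R) : \sum_i F i = \sum_(i in T) F i + \sum_(i in ~: T) F i.
  rewrite (bigID (mem T))/=; congr (_ + _).
  by apply: eq_bigl => i; rewrite finset.in_setC.
rewrite !split.
have onT : \sum_(i in T) `|x i 0| `^ q <=
    \sum_(i in T) `|(x + h) i 0| `^ q + \sum_(i in T) `|h i 0| `^ q.
  rewrite -big_split/=; apply: ler_sum => i _.
  by have := norm_powR_triangle ((x + h) i 0) (- h i 0) q01; rewrite mxE addrK normrN.
have offT : \sum_(i in ~: T) `|h i 0| `^ q <=
    \sum_(i in ~: T) `|(x + h) i 0| `^ q + \sum_(i in ~: T) `|x i 0| `^ q.
  rewrite -big_split/=; apply: ler_sum => i _.
  by have := norm_powR_triangle ((x + h) i 0) (- x i 0) q01;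
    rewrite mxE [x i 0 + _]addrC addrK normrN.
by move: onT offT; lra.
Qed.

(** * Restriction of vectors to index sets *)

Definition restrictv (R : realType) k (B : {set 'I_k}) (x : 'cV[R]_k) : 'cV[R]_k :=
  \col_i (if i \in B then x i 0 else 0).

Lemma head_s_restrict (R : realType) (s k : nat) (x : 'cV[R]_k) :
  exists2 T : {set 'I_k}, (#|T| <= s)%N & head_s s x = restrictv T x.
Proof.
set l := take s (sort (fun i j : 'I_k => `|x j 0| <= `|x i 0|) (enum 'I_k)).
exists [set i in l]%SET; last by apply/colP => i; rewrite !mxE finset.inE.
by rewrite cardsE (leq_trans (card_size _))// size_take_min geq_minl.
Qed.

Lemma lqpow_sub_restrict (R : realType) (q : R) k (x : 'cV[R]_k) (T : {set 'I_k}) :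
  0 < q -> lqpow q (x - restrictv T x) = \sum_(i in ~: T) `|x i 0| `^ q.
Proof.
move=> q0; rewrite /lqpow [RHS]big_mkcond/=; apply: eq_bigr => i _.
rewrite !mxE finset.in_setC; case: ifP => _ /=; last by rewrite subr0.
by rewrite subrr normr0 powR0// gt_eqF.
Qed.

Lemma nnz_restrict (R : realType) k (x : 'cV[R]_k) (B : {set 'I_k}) :
  (nnz (restrictv B x) <= #|B|)%N.
Proof.
apply: subset_leq_card; apply/fintype.subsetP => i; rewrite finset.inE mxE.
by case: ifP => //; rewrite eqxx.
Qed.

Lemma restrictU (R : realType) k (x : 'cV[R]_k) (B B' : {set 'I_k}) :
  [disjoint B & B'] -> restrictv (B :|: B') x = restrictv B x + restrictv B' x.
Proof.
move=> dis; apply/colP => i; rewrite !mxE finset.in_setU.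
case: (boolP (i \in B)) => iB /=; last by rewrite add0r.
by rewrite (disjointFr dis iB) addr0.
Qed.

Lemma dotv_restrict (R : realType) k (x : 'cV[R]_k) (B : {set 'I_k}) :
  dotv (restrictv B x) (restrictv B x) = \sum_(i in B) `|x i 0| `^ 2.
Proof.
rewrite dotvE [RHS]big_mkcond/=; apply: eq_bigr => i _; rewrite !mxE.
case: ifP => _; last by rewrite mulr0.
by rewrite powR_mulrn// real_normK ?num_real// expr2.
Qed.

Lemma dotv_restrictl (R : realType) k (x : 'cV[R]_k) (B : {set 'I_k}) :
  dotv (restrictv B x) (restrictv B x) = dotv (restrictv B x) x.
Proof.
rewrite !dotvE; apply: eq_bigr => i _; rewrite !mxE.
by case: ifP; rewrite ?mul0r.
Qed.

Lemma dotv_restrictC (R : realType) k (x : 'cV[R]_k) (B : {set 'I_k}) :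
  dotv x x = dotv (restrictv B x) (restrictv B x)
             + dotv (restrictv (~: B) x) (restrictv (~: B) x).
Proof.
rewrite !dotvE -big_split/=; apply: eq_bigr => i _; rewrite !mxE finset.in_setC.
by case: ifP; rewrite /= ?mul0r ?add0r ?addr0.
Qed.

Lemma restrictC (R : realType) k (x : 'cV[R]_k) (B : {set 'I_k}) :
  x = restrictv B x + restrictv (~: B) x.
Proof.
apply/colP => i; rewrite !mxE finset.in_setC.
by case: ifP; rewrite /= ?add0r ?addr0.
Qed.

(** * Scalar inequalities that absorb the head energy *)

(** Both hypotheses are raised to the power [2 / q], where they add, and the sum is brought back to
    the power [q / 2]. *)
Lemma energy_bound (R : realType) (q rho y P Q : R) :
  0 < q -> 0 < rho -> 0 <= P -> 0 <= Q -> 0 <= y ->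
  P `^ (q / 2) <= y -> Q `^ (q / 2) <= rho `^ (1 - q / 2) * y ->
  (P + Q) `^ (q / 2) <= (rho `^ (2 / q - 1) + 1) `^ (q / 2) * y.
Proof.
move=> q0 rho0 P0 Q0 y0 Py Qy.
have p0 : 0 < q / 2 by rewrite divr_gt0.
have pV : (q / 2)^-1 = 2 / q by rewrite invf_div.
have p0V : 0 <= (q / 2)^-1 by rewrite invr_ge0 ltW.
have root z b : 0 <= z -> z `^ (q / 2) <= b -> z <= b `^ (2 / q).
  move=> z0 zb; rewrite -[leLHS](powRKV p0 z0) pV.
  by apply: ler_powRl; rewrite ?powR_ge0// -pV.
have rhoE : (rho `^ (1 - q / 2)) `^ (2 / q) = rho `^ (2 / q - 1).
  by rewrite -powRrM; congr (_ `^ _); field; rewrite gt_eqF.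
have {}Py := root _ _ P0 Py; have {}Qy := root _ _ Q0 Qy.
rewrite powRM ?powR_ge0// rhoE in Qy.
have yE : (y `^ (2 / q)) `^ (q / 2) = y.
  by rewrite -pV powRVK.
rewrite -yE -powRM ?powR_ge0 ?addr_ge0 ?powR_ge0//.
apply: ler_powRl; rewrite ?(ltW p0) ?addr_ge0//.
by rewrite mulrDl mul1r addrC lerD.
Qed.

(** The left-hand side of the assumption on the RIP constants. The two constants after it are the
    coefficients obtained when the final linear inequality is solved for the head energy; their
    common denominator is the slack in that assumption. *)
Definition recovery_gain (R : realType) (delta_a rho q kappa : R) : R :=
  rho `^ (1 - q / 2) * (rho `^ (2 / q - 1) + 1) `^ (q / 2) * kappa `^ q
    * (1 + delta_a).

Definition noise_const (R : realType) (delta_a delta_sa rho q L kappa : R) : R :=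
  (kappa * L) `^ (q / 2) * (rho `^ (2 / q - 1) + 1) `^ (q / 2)
    / (1 - delta_sa - recovery_gain delta_a rho q kappa).

Definition tail_const (R : realType) (delta_a delta_sa rho q kappa : R) : R :=
  2 * (1 - delta_sa + recovery_gain delta_a rho q kappa)
    / (1 - delta_sa - recovery_gain delta_a rho q kappa).

(* With [u = P `^ (q / 2)], [y = u + 2 * eta] and [W] the numerator of [noise_const], the two
   frame inequalities give [u ^+ 2 <= W * X `^ (q / 2) * y], hence
   [u - 2 * eta <= W * X `^ (q / 2)], which is linear in [u]. *)
Lemma head_energy_bound (R : realType) (q rho L kappa da dsa P Q X eta tau : R) :
  0 < q -> 0 < rho -> 0 < L -> 1 <= kappa -> 0 <= da ->
  0 <= P -> 0 <= Q -> 0 <= X -> 0 <= eta -> 0 <= tau ->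
  recovery_gain da rho q kappa < 1 - dsa ->
  P ^+ 2 <= kappa * L * X * (P + Q) ->
  Q `^ (q / 2) <= rho `^ (1 - q / 2) * (P `^ (q / 2) + 2 * eta) ->
  (1 - dsa) * X `^ (q / 2) <=
    tau + (1 + da) * L^-1 `^ (q / 2) * (rho `^ (1 - q / 2) * (P `^ (q / 2) + 2 * eta)) ->
  P `^ (q / 2) <= noise_const da dsa rho q L kappa * tau
                  + tail_const da dsa rho q kappa * eta.
Proof.
move=> q0 rho0 L0 k1 da0 P0 Q0 X0 eta0 tau0 gain PX Qy Xtau.
have k0 : 0 < kappa by rewrite (lt_le_trans _ k1).
set u := P `^ (q / 2) in Qy Xtau *; have u0 : 0 <= u by rewrite powR_ge0.
have p0 : 0 < q / 2 by rewrite divr_gt0.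
have y0 : 0 <= u + 2 * eta by rewrite addr_ge0// mulr_ge0.
have uy : u <= u + 2 * eta by rewrite lerDl mulr_ge0.
have energy := energy_bound q0 rho0 P0 Q0 y0 uy Qy.
rewrite /noise_const /tail_const; set t := (_ + 1) `^ (q / 2) in energy *.
have t0 : 0 <= t by rewrite powR_ge0.
set W := (kappa * L) `^ (q / 2) * t; set Y := X `^ (q / 2) in Xtau *.
have W0 : 0 <= W by rewrite mulr_ge0// powR_ge0.
have Y0 : 0 <= Y by rewrite powR_ge0.
have uW : u ^+ 2 <= W * Y * (u + 2 * eta).
  have kL0 : 0 <= kappa * L by rewrite mulr_ge0// ltW.
  apply: (@le_trans _ _ ((P ^+ 2) `^ (q / 2))).
    by rewrite -!powR_mulrn ?powR_ge0// powRAC.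
  have := ler_powRl (ltW p0) (exprn_ge0 2 P0) PX; move=> /le_trans; apply.
  rewrite (powRM _ (mulr_ge0 kL0 X0) (addr_ge0 P0 Q0)) (powRM _ kL0 X0).
  rewrite /W -!mulrA ler_wpM2l ?powR_ge0//.
  by rewrite mulrCA ler_wpM2l ?powR_ge0.
(* For [y = u + 2 * eta > 0], divide [(u - 2 * eta) * y = u^2 - 4 * eta^2 <= u^2] by [y]. *)
have {}uW : u - 2 * eta <= W * Y.
  move: y0; rewrite le0r => /predU1P[y0|y0].
    by have := mulr_ge0 W0 Y0; lra.
  rewrite -(ler_pM2r y0); apply: le_trans uW.
  by have := sqr_ge0 eta; rewrite expr2; lra.
set g := recovery_gain _ _ _ _ in gain *.
(* The powers of [L] cancel and leave [kappa^(q/2)], which is at most [kappa^q] because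
   [kappa >= 1]. *)
have Wc : W * ((1 + da) * L^-1 `^ (q / 2) * rho `^ (1 - q / 2)) <= g.
  have -> : W * ((1 + da) * L^-1 `^ (q / 2) * rho `^ (1 - q / 2)) =
     rho `^ (1 - q / 2) * t * kappa `^ (q / 2) * (1 + da).
    rewrite -[kappa in RHS](mulfK (lt0r_neq0 L0)) [in RHS]powRM ?invr_ge0 ?mulr_ge0 ?(ltW L0) ?(ltW k0)//.
    by rewrite /W; ring.
  rewrite /g /recovery_gain -/t ler_wpM2r ?addr_ge0// ler_wpM2l ?mulr_ge0 ?powR_ge0//.
  by rewrite ler_powR// ler_pdivrMr// ler_peMr ?ltW// ltr1n.
set c := (1 + da) * _ * rho `^ _ in Wc.
have {}Xtau : (1 - dsa) * Y <= tau + c * (u + 2 * eta) by rewrite /c -mulrA.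
have g0 : 0 <= g by rewrite !mulr_ge0 ?powR_ge0 ?addr_ge0.
have b0 : 0 <= 1 - dsa by rewrite (le_trans g0) ?ltW.
have bg0 : 0 < 1 - dsa - g by rewrite subr_gt0.
rewrite [W / _ * _]mulrAC [_ / _ * eta]mulrAC -mulrDl ler_pdivlMr//.
(* Chained, these give [(1 - dsa) * (u - 2 * eta) <= W * tau + g * (u + 2 * eta)], and [g < 1 - dsa]
   allows solving for [u]. *)
have e1 := ler_wpM2l b0 uW.
have e2 := ler_wpM2l W0 Xtau.
have e3 := ler_wpM2r y0 Wc.
by move: e1 e2 e3; clear; move=> e1 e2 e3; lra.
Qed.

(** * Head and tail estimates, and robust recovery in [q]-th powers *)

Lemma dotv_restrictU (R : realType) k (x : 'cV[R]_k) (B B' : {set 'I_k}) :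
  [disjoint B & B'] ->
  dotv (restrictv (B :|: B') x) (restrictv (B :|: B') x) =
  dotv (restrictv B x) (restrictv B x) + dotv (restrictv B' x) (restrictv B' x).
Proof.
move=> dis; rewrite !dotv_restrict -bigU//=.
by apply: eq_bigl => i; rewrite !inE.
Qed.

(** [tail_bound] with weights [|x_i|^q] and [p = 2 / q], so that the block quantity is the Euclidean
    norm to the power [q]. On one block, the RIP of order [a] and the norm bound for the dual frame
    supply the constant. *)
Lemma rip_tail_bound (R : realType) (q L U da : R) m n d (A : 'M[R]_(m, n))
    (D : 'M[R]_(n, d)) (a : nat) (x : 'cV[R]_d) (S B : {set 'I_d}) :
  0 < q <= 1 -> (0 < a)%N -> is_frame D L U -> EqRIP A (dual_frame D) q a da ->
  B \subset S -> (B == S) || (#|B| == a) ->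
  {in B & S :\: B, forall i j, `|x j 0| `^ q <= `|x i 0| `^ q} ->
  lqpow q (A *m (dual_frame D *m restrictv (S :\: B) x)) <=
    (1 + da) * L^-1 `^ (q / 2) * a%:R `^ (q / 2 - 1) * \sum_(i in S) `|x i 0| `^ q.
Proof.
move=> q01 a0 frameD [/andP[da0 _] ripA] BS cB top.
have /andP[q0 q1] := q01; have [L0 _] := frameD.
have pV : (2 / q)^-1 = q / 2 by rewrite invf_div.
rewrite -[in X in a%:R `^ X]pV.
pose F (B : {set 'I_d}) := lqpow q (A *m (dual_frame D *m restrictv B x)).
apply: (@tail_bound _ _ _ F) => //.
- by rewrite divr_gt0.
- by rewrite mulr_ge0 ?powR_ge0 ?addr_ge0.
- by move=> i; exact: powR_ge0.
- by move=> C C' dis; rewrite /F restrictU// !mulmxDr lqpowD.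
move=> C Ca; rewrite pV /F.
have -> : \sum_(i in C) (`|x i 0| `^ q) `^ (2 / q) = dotv (restrictv C x) (restrictv C x).
  rewrite dotv_restrict; apply: eq_bigr => i _.
  by rewrite -powRrM mulrC divfK ?gt_eqF.
have [_] := ripA _ (leq_trans (nnz_restrict x C) Ca); move=> /le_trans; apply.
rewrite -mulrA lqnorm2E ler_wpM2l ?addr_ge0// -powRM ?dotv_ge0 ?invr_ge0 ?(ltW L0)//.
apply: ler_powRl; rewrite ?dotv_ge0 ?divr_ge0 ?(ltW q0)//.
by rewrite mulrC ler_pdivlMr// mulrC (dual_frame_bound frameD).
Qed.

(** The same block argument for the Euclidean energy itself, with constant 1. *)
Lemma energy_tail_bound (R : realType) (q : R) d (a : nat) (x : 'cV[R]_d)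
    (S B : {set 'I_d}) :
  0 < q <= 1 -> (0 < a)%N ->
  B \subset S -> (B == S) || (#|B| == a) ->
  {in B & S :\: B, forall i j, `|x j 0| `^ q <= `|x i 0| `^ q} ->
  dotv (restrictv (S :\: B) x) (restrictv (S :\: B) x) `^ (q / 2) <=
    a%:R `^ (q / 2 - 1) * \sum_(i in S) `|x i 0| `^ q.
Proof.
move=> /andP[q0 q1] a0 BS cB top.
have pV : (2 / q)^-1 = q / 2 by rewrite invf_div.
rewrite -[in X in a%:R `^ X]pV -[a%:R `^ _]mul1r.
pose F (B : {set 'I_d}) := dotv (restrictv B x) (restrictv B x) `^ (q / 2).
apply: (@tail_bound _ _ _ F) => //.
- by rewrite divr_gt0.
- by move=> i; exact: powR_ge0.
- move=> C C' dis; rewrite /F dotv_restrictU//.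
  apply: powR_subadd; rewrite ?dotv_ge0// divr_gt0//= ler_pdivrMr// mul1r.
  by rewrite (le_trans q1)// ler1n.
move=> C Ca; rewrite pV /F mul1r dotv_restrict.
rewrite (eq_bigr (fun i => (`|x i 0| `^ q) `^ (2 / q)))// => i _.
by rewrite -[in RHS]powRrM mulrC divfK ?gt_eqF.
Qed.

Lemma head_lq_bound (R : realType) (q : R) d (s : nat) (x : 'cV[R]_d) (T T' : {set 'I_d}) :
  0 < q <= 1 -> (#|T| <= s)%N -> T \subset T' ->
  \sum_(i in T) `|x i 0| `^ q <=
    s%:R `^ (1 - q / 2) * dotv (restrictv T' x) (restrictv T' x) `^ (q / 2).
Proof.
move=> /andP[q0 q1] Ts TT'.
have h2 : 0 < q / 2 <= 1 by rewrite divr_gt0//= ler_pdivrMr// mul1r (le_trans q1)// ler1n.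
have /andP[h20 h21] := h2.
have := sum_powR_le (mem T) h2 (fun i => powR_ge0 `|x i 0| 2).
have -> : \sum_(i in mem T) (`|x i 0| `^ 2) `^ (q / 2) = \sum_(i in T) `|x i 0| `^ q.
  by apply: eq_bigr => i _; rewrite -powRrM mulrC divfK ?pnatr_eq0.
move=> /le_trans; apply; apply: ler_pM; rewrite ?powR_ge0//.
  by apply: ler_powRl; rewrite ?subr_ge0// ler_nat.
apply: ler_powRl; first exact: ltW.
  by apply: sumr_ge0 => i _; exact: powR_ge0.
rewrite dotv_restrict [leRHS](big_setID T)/= (finset.setIidPr TT') lerDl.
by apply: sumr_ge0 => i _; exact: powR_ge0.
Qed.

(** Stays in [q]-th powers, where both conclusions are linear in the noise level [tau] and the
    approximation error [sigma]. *)
Lemma robust_recovery (R : realType) (q L U da dsa tau sigma : R) m n d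
    (A : 'M[R]_(m, n)) (D : 'M[R]_(n, d)) (s a : nat) (h : 'cV[R]_n)
    (T : {set 'I_d}) (rho := s%:R / a%:R) (kappa := U / L) (x := D^T *m h) :
  0 < q <= 1 -> (0 < s)%N -> (0 < a)%N -> is_frame D L U ->
  EqRIP A (dual_frame D) q a da -> EqRIP A (dual_frame D) q (s + a) dsa ->
  recovery_gain da rho q kappa < 1 - dsa ->
  (#|T| <= s)%N -> 0 <= sigma -> 0 <= tau -> lqpow q (A *m h) <= tau ->
  \sum_(i in ~: T) `|x i 0| `^ q <= \sum_(i in T) `|x i 0| `^ q + 2 * sigma ->
  dotv h h `^ (q / 2) <=
      L^-1 `^ (q / 2) * (rho `^ (2 / q - 1) + 1) `^ (q / 2)
      * (noise_const da dsa rho q L kappa * tau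
         + (tail_const da dsa rho q kappa + 2) * (sigma / s%:R `^ (1 - q / 2))) /\
  lqpow q x <= 2 * noise_const da dsa rho q L kappa * s%:R `^ (1 - q / 2) * tau
               + (2 * tail_const da dsa rho q kappa + 2) * sigma.
Proof.
move=> q01 s0 a0 frameD ripa ripsa gain Ts sigma0 tau0 Ah cone.
have /andP[q0 q1] := q01; have [L0 [LU _]] := frameD.
have h20 : 0 < q / 2 by rewrite divr_gt0.
have s0R : 0 < s%:R :> R by rewrite ltr0n.
have a0R : 0 < a%:R :> R by rewrite ltr0n.
have rho0 : 0 < rho by rewrite divr_gt0.
have k1 : 1 <= kappa by rewrite ler_pdivlMr// mul1r.
have kL : kappa * L = U by rewrite divfK ?gt_eqF.
have [B [BS Ba cB top]] := top_subset (fun i => `|x i 0| `^ q) a (~: T).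
set T' := T :|: B; have T'C : ~: T' = ~: T :\: B.
  by rewrite finset.setCU finset.setDE.
set v := restrictv T' x; set v' := restrictv (~: T') x.
have hE : dual_frame D *m v = h - dual_frame D *m v'.
  by rewrite -{1}(dual_frameK frameD h) -/x {1}(restrictC x T') mulmxDr addrK.
(* [Ss] is the factor comparing the [q]-power sum on [T] with the Euclidean energy; with
   [sigma = Ss * eta] it factors out of the cone constraint. *)
set Ss := s%:R `^ (1 - q / 2); have Ss0 : 0 < Ss by rewrite powR_gt0.
set eta := sigma / Ss; have eta0 : 0 <= eta by rewrite divr_ge0// ltW.
have sE : sigma = Ss * eta by rewrite mulrC divfK ?gt_eqF.
set G := \sum_(i in ~: T) `|x i 0| `^ q in cone.
set u := dotv v v `^ (q / 2).
have headT : \sum_(i in T) `|x i 0| `^ q <= Ss * u.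
  by apply: head_lq_bound => //; exact: finset.subsetUl.
have GE : G <= Ss * (u + 2 * eta).
  by move: cone headT; rewrite sE mulrDr; lra.
have rhoE : a%:R `^ (q / 2 - 1) * Ss = rho `^ (1 - q / 2).
  rewrite /rho powRM ?ler0n ?invr_ge0// mulrC; congr (_ * _).
  by rewrite -[a%:R^-1](powR_inv1 (ler0n _ a)) -powRrM; congr (_ `^ _); ring.
have aG : a%:R `^ (q / 2 - 1) * G <= rho `^ (1 - q / 2) * (u + 2 * eta).
  by rewrite -rhoE -mulrA ler_wpM2l ?powR_ge0.
have c0 : 0 <= (1 + da) * L^-1 `^ (q / 2).
  by have [/andP[da0 _] _] := ripa; rewrite mulr_ge0 ?powR_ge0 ?addr_ge0.
have tailA : lqpow q (A *m (dual_frame D *m v')) <=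
    (1 + da) * L^-1 `^ (q / 2) * (rho `^ (1 - q / 2) * (u + 2 * eta)).
  rewrite /v' T'C; apply: le_trans (rip_tail_bound (x := x) q01 a0 frameD ripa BS cB top) _.
  by rewrite -mulrA ler_wpM2l.
have tail2 : dotv v' v' `^ (q / 2) <= rho `^ (1 - q / 2) * (u + 2 * eta).
  by rewrite /v' T'C (le_trans (energy_tail_bound (x := x) q01 a0 BS cB top)).
(* [v] has at most [s + a] nonzero entries, so the lower RIP bound applies; by [hE] its synthesis is
   [h] minus the synthesized tail. *)
have lowA : (1 - dsa) * dotv (dual_frame D *m v) (dual_frame D *m v) `^ (q / 2) <=
    tau + (1 + da) * L^-1 `^ (q / 2) * (rho `^ (1 - q / 2) * (u + 2 * eta)).
  have vsa : (nnz v <= s + a)%N.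
    rewrite (leq_trans (nnz_restrict _ _))// (leq_trans (leq_card_setU _ _))//.
    by rewrite leq_add.
  have [_ /(_ v vsa)[+ _]] := ripsa; rewrite lqnorm2E => /le_trans; apply.
  rewrite {1}hE mulmxBr (le_trans (lqpowD _ _ q01))// lqpowN.
  by rewrite lerD.
have xx : dotv x x = dotv v v + dotv v' v' by exact: dotv_restrictC.
have ubound : u <= noise_const da dsa rho q L kappa * tau
                   + tail_const da dsa rho q kappa * eta.
  apply: (head_energy_bound q0 rho0 L0 k1 _ (dotv_ge0 v) (dotv_ge0 v')
    (dotv_ge0 (dual_frame D *m v))) => //; first by have [/andP[]] := ripa.
  rewrite kL -xx; apply: (frame_restriction_bound frameD).
  exact: dotv_restrictl.
split; last first.
  have -> : lqpow q x = \sum_(i in T) `|x i 0| `^ q + G.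
    rewrite /lqpow (bigID (mem T))/=; congr (_ + _).
    by apply: eq_bigl => i; rewrite finset.in_setC.
  have := ler_wpM2l (ltW Ss0) ubound.
  (* The cone constraint gives at most twice the head sum plus [2 * sigma], and the head sum is at
     most [Ss * u]. *)
  by move: headT cone; rewrite sE; lra.
apply: (@le_trans _ _ (L^-1 `^ (q / 2) * dotv x x `^ (q / 2))).
  rewrite -powRM ?dotv_ge0 ?invr_ge0 ?(ltW L0)//.
  apply: ler_powRl; rewrite ?dotv_ge0 ?(ltW h20)//.
  by rewrite mulrC ler_pdivlMr// mulrC (frame_lower frameD).
rewrite -mulrA ler_wpM2l ?powR_ge0// xx.
have y0 : 0 <= u + 2 * eta by rewrite addr_ge0 ?powR_ge0// mulr_ge0.
have uy : u <= u + 2 * eta by rewrite lerDl mulr_ge0.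
apply: le_trans (energy_bound q0 rho0 (dotv_ge0 v) (dotv_ge0 v') y0 uy tail2) _.
by rewrite ler_wpM2l ?powR_ge0//; move: ubound; clear; lra.
Qed.

(** * Passage to [q]-th roots, explicit constants and the theorem *)

(** A sum is at most twice its larger term. With [p = 1 / q] this separates noise and approximation
    error, at the price of a factor 2 inside the root. *)
Lemma powRD_le (R : realType) (p x y : R) :
  0 <= p -> 0 <= x -> 0 <= y -> (x + y) `^ p <= (2 * x) `^ p + (2 * y) `^ p.
Proof.
move=> p0 x0 y0; have [xy|/ltW yx] := leP x y.
  apply: le_trans (_ : (2 * y) `^ p <= _); last by rewrite lerDr powR_ge0.
  by apply: ler_powRl => //; [exact: addr_ge0|lra].
apply: le_trans (_ : (2 * x) `^ p <= _); last by rewrite lerDl powR_ge0.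
by apply: ler_powRl => //; [exact: addr_ge0|lra].
Qed.

Lemma lqnorm2_powRV (R : realType) (q : R) k (u : 'cV[R]_k) :
  0 < q -> lqnorm 2 u = (dotv u u `^ (q / 2)) `^ q^-1.
Proof. by move=> q0; rewrite -lqnorm2E powRKV// powR_ge0. Qed.

Definition synthesis_const (R : realType) (rho q L : R) : R :=
  L^-1 `^ (q / 2) * (rho `^ (2 / q - 1) + 1) `^ (q / 2).

(** The factor 2 comes from [powRD_le]; in [C2_const] it becomes 4, because the noise level [tau]
    contains another 2. *)
Definition C1_const (R : realType) (delta_a delta_sa rho q L kappa : R) : R :=
  (2 * synthesis_const rho q L * (tail_const delta_a delta_sa rho q kappa + 2)) `^ q^-1.

Definition C2_const (R : realType) (delta_a delta_sa rho q L kappa : R) : R :=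
  (4 * synthesis_const rho q L * noise_const delta_a delta_sa rho q L kappa) `^ q^-1.

Definition C3_const (R : realType) (delta_a delta_sa rho q L kappa : R) : R :=
  2 * tail_const delta_a delta_sa rho q kappa + 2.

Definition C4_const (R : realType) (delta_a delta_sa rho q L kappa : R) : R :=
  4 * noise_const delta_a delta_sa rho q L kappa.

Theorem theorem2p1 (R : realType) :
  exists C1 C2 C3 C4 : R -> R -> R -> R -> R -> R -> R,
  forall (q : R) (r : \bar R) (eps : R) (m n d : nat)
    (A : 'M[R]_(m, n)) (f : 'cV[R]_n) (z : 'cV[R]_m)
    (D : 'M[R]_(n, d)) (L U : R) (s a : nat) (delta_a delta_sa : R),
  0 < q <= 1 -> (1 <= r)%E -> 0 <= eps ->
  lrnorm r z <= eps ->
  is_frame D L U ->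
  (0 < s)%N -> (s < a)%N ->
  let y := A *m f + z in
  let rho := s%:R / a%:R in
  let kappa := U / L in
  is_RIP_constant A (dual_frame D) q a delta_a ->
  is_RIP_constant A (dual_frame D) q (s + a) delta_sa ->
  rho `^ (1 - q / 2) * (rho `^ (2 / q - 1) + 1) `^ (q / 2) * kappa `^ q
    * (1 + delta_a) < 1 - delta_sa ->
  [/\ 0 < C1 delta_a delta_sa rho q L kappa,
      0 < C2 delta_a delta_sa rho q L kappa,
      0 < C3 delta_a delta_sa rho q L kappa,
      0 < C4 delta_a delta_sa rho q L kappa &
  forall fhat : 'cV[R]_n,
    lrnorm r (A *m fhat - y) <= eps ->
    (forall g : 'cV[R]_n, lrnorm r (A *m g - y) <= eps ->
       lqnorm q (D^T *m fhat) <= lqnorm q (D^T *m g)) ->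
    lqnorm 2 (fhat - f)
      <= C1 delta_a delta_sa rho q L kappa
           * lqnorm q (D^T *m f - head_s s (D^T *m f)) / s%:R `^ (q^-1 - 2^-1)
         + C2 delta_a delta_sa rho q L kappa * m%:R `^ (q^-1 - einv r) * eps
    /\
    lqpow q (D^T *m fhat - D^T *m f)
      <= C3 delta_a delta_sa rho q L kappa
           * lqpow q (D^T *m f - head_s s (D^T *m f))
         + C4 delta_a delta_sa rho q L kappa * a%:R `^ (1 - q / 2)
           * m%:R `^ (1 - q * einv r) * eps `^ q].
Proof.
exists (@C1_const R), (@C2_const R), (@C3_const R), (@C4_const R).
move=> q r eps m n d A f z D L U s a da dsa q01 r1 eps0 zeps frameD s0 sa y rho kappa.
move=> [ripa _] [ripsa _] gain; have /andP[q0 q1] := q01.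
have [L0 [LU _]] := frameD; have a0 : (0 < a)%N by rewrite (leq_trans _ sa).
have h20 : 0 < q / 2 by rewrite divr_gt0.
have s0R : 0 < s%:R :> R by rewrite ltr0n.
have a0R : 0 < a%:R :> R by rewrite ltr0n.
have rho0 : 0 < rho by rewrite divr_gt0.
have U0 : 0 < U by rewrite (lt_le_trans L0).
have k0 : 0 < kappa by rewrite divr_gt0.
have da0 : 0 <= da by have [/andP[]] := ripa.
have t0 : 0 < (rho `^ (2 / q - 1) + 1) `^ (q / 2).
  by rewrite powR_gt0// addr_gt0 ?powR_gt0.
have g0 : 0 < recovery_gain da rho q kappa.
  by rewrite !mulr_gt0// ?powR_gt0// ltr_pwDl.
have bg0 : 0 < 1 - dsa - recovery_gain da rho q kappa by rewrite subr_gt0.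
have K10 : 0 < noise_const da dsa rho q L kappa.
  by apply: divr_gt0 => //; apply: mulr_gt0 => //; rewrite powR_gt0// mulr_gt0.
have K20 : 0 < tail_const da dsa rho q kappa.
  rewrite divr_gt0// mulr_gt0// addr_gt0//.
  by rewrite (lt_trans g0).
have V0 : 0 < synthesis_const rho q L.
  by apply: mulr_gt0 => //; rewrite powR_gt0// invr_gt0.
split.
- by apply/powR_gt0/mulr_gt0; [exact: mulr_gt0|exact: addr_gt0].
- by apply/powR_gt0/mulr_gt0 => //; exact: mulr_gt0.
- by apply: addr_gt0 => //; exact: mulr_gt0.
- exact: mulr_gt0.
move=> fhat fhateps fhatmin.
set x := D^T *m f; set h := fhat - f; set M := m%:R `^ (1 - q * einv r).
(* [A *m h] is the sum of the residual of [fhat] and the noise [z], each contributing at most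
   [M * eps^q]. *)
pose tau := 2 * (M * eps `^ q); pose sigma := lqpow q (x - head_s s x).
have tau0 : 0 <= tau by rewrite !mulr_ge0 ?powR_ge0.
have sigma0 : 0 <= sigma by exact: lqpow_ge0.
have fz : A *m f - y = - z by rewrite opprD addNKr.
have Ah : lqpow q (A *m h) <= tau.
  have -> : A *m h = (A *m fhat - y) + z by rewrite mulmxBr opprD addrA subrK.
  rewrite (le_trans (lqpowD _ _ q01))// /tau mulr_natl mulr2n.
  by rewrite lerD// lqpow_le_lrnorm.
have Dh : D^T *m h = D^T *m fhat - x by rewrite mulmxBr.
(* The true signal is a competitor in the minimization, since its residual is [- z]. *)
have feasible : lrnorm r (A *m f - y) <= eps.
  suff -> : lrnorm r (A *m f - y) = lrnorm r z by [].
  rewrite fz; case: r {r1 zeps fhateps fhatmin M tau tau0 Ah} => [r| |] /=.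
  - by congr (_ `^ _); apply: eq_bigr => i _; rewrite mxE normrN.
  - by apply: eq_bigr => i _; rewrite mxE normrN.
  - by apply: eq_bigr => i _; rewrite mxE normrN.
have hmin : lqpow q (D^T *m fhat) <= lqpow q x.
  rewrite -(lqnormK _ q0) -(lqnormK x q0).
  by apply: ler_powRl (fhatmin f feasible); [exact: ltW|exact: powR_ge0].
have [T Ts xT] := head_s_restrict s x.
have cone : \sum_(i in ~: T) `|(D^T *m h) i 0| `^ q <=
    \sum_(i in T) `|(D^T *m h) i 0| `^ q + 2 * sigma.
  rewrite /sigma xT (lqpow_sub_restrict _ _ q0); apply: (cone_constraint _ q01).
  by rewrite Dh addrC subrK.
have [hbound xbound] :=
  robust_recovery q01 s0 a0 frameD ripa ripsa gain Ts sigma0 tau0 Ah cone.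
split; last first.
  rewrite -Dh; apply: le_trans xbound _; rewrite addrC lerD2l /C4_const /tau.
  rewrite -/M -/rho -/kappa; set K1 := noise_const _ _ _ _ _ _ in K10 *.
  (* The noise term carries a power of [s]; [s < a] turns it into the stated power of [a]. *)
  have sa' : s%:R `^ (1 - q / 2) <= a%:R `^ (1 - q / 2) :> R.
    apply: ler_powRl; rewrite ?ler0n ?ler_nat ?(ltnW sa)//.
    by rewrite subr_ge0 ler_pdivrMr// mul1r (le_trans q1)// ler1n.
  have Me0 : 0 <= 4 * K1 * (M * eps `^ q).
    exact: mulr_ge0 (mulr_ge0 (ler0n _ 4) (ltW K10)) (mulr_ge0 (powR_ge0 _ _) (powR_ge0 _ _)).
  by have := ler_wpM2r Me0 sa'; lra.
have qV0 : 0 <= q^-1 by rewrite invr_ge0 ltW.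
rewrite (lqnorm2_powRV _ q0).
apply: le_trans (ler_powRl qV0 (powR_ge0 _ _) hbound) _.
rewrite -/rho -/kappa -/(synthesis_const rho q L).
set K1 := noise_const _ _ _ _ _ _ in K10 *; set K2 := tail_const _ _ _ _ _ in K20 *.
set V := synthesis_const _ _ _ in V0 *.
have K22 : 0 <= K2 + 2 by exact: addr_ge0 (ltW K20) (ler0n _ 2).
have eta0 : 0 <= sigma / s%:R `^ (1 - q / 2) by rewrite divr_ge0 ?powR_ge0.
rewrite mulrDr addrC; apply: le_trans (powRD_le qV0 _ _) _.
- exact: mulr_ge0 (ltW V0) (mulr_ge0 K22 eta0).
- exact: mulr_ge0 (ltW V0) (mulr_ge0 (ltW K10) tau0).
rewrite /C1_const /C2_const -/K1 -/K2 -/V.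
have -> : 2 * (V * ((K2 + 2) * (sigma / s%:R `^ (1 - q / 2)))) =
    2 * V * (K2 + 2) * (sigma * (s%:R `^ (1 - q / 2))^-1) by ring.
have -> : 2 * (V * (K1 * tau)) = 4 * V * K1 * M * eps `^ q by rewrite /tau; ring.
have V20 : 0 <= 2 * V * (K2 + 2) by exact: mulr_ge0 (mulr_ge0 (ler0n _ 2) (ltW V0)) K22.
have VK0 : 0 <= 4 * V * K1 by exact: mulr_ge0 (mulr_ge0 (ler0n _ 4) (ltW V0)) (ltW K10).
rewrite (powRM _ V20 eta0) (powRM _ sigma0 _) ?invr_ge0 ?powR_ge0//.
rewrite (powRM _ (mulr_ge0 VK0 (powR_ge0 _ _)) (powR_ge0 _ _)).
rewrite (powRM _ VK0 (powR_ge0 _ _)) powRKV// -powRN -!powRrM mulrA.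
(* The [q]-th root turns the exponents of [s] and [m] into those of the first estimate. *)
have -> : - (1 - q / 2) / q = - (q^-1 - 2^-1) by field; rewrite gt_eqF.
have -> : (1 - q * einv r) / q = q^-1 - einv r by field; rewrite gt_eqF.
by rewrite powRN.
Qed.
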